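(* For every class $\mathcal H$, if $\mathtt{VC}(\mathcal H)\le1$ then $\mathtt{sd}(\mathcal H)\le1$. Equivalently, if $\mathtt{sd}(\mathcal H)\ge2$ then $\mathtt{VC}(\mathcal H)\ge2$.
   Context: A class $\mathcal H$ over a domain $X$ is a nonempty set of functions $X\to\{-,+\}$; $\mathtt{VC}(\mathcal H)$ is the maximal size of $S\subseteq X$ such that every $s:S\to\{-,+\}$ equals $h|_S$ for some $h\in\mathcal H$. For finite $X'\subseteq X$, let $\Delta(\mathcal H|_{X'})$ be the simplicial complex (equivalently, the space of probability distributions on $X'\times\{-,+\}$ realizable by $\mathcal H|_{X'}$) with vertex set $X'\times\{-,+\}$ whose simplices are the sets $F$ such that some $h\in\mathcal H$ has $h(x)=y$ for all $(x,y)\in F$; a distribution $\mu$ is the point with barycentric coordinates $\mu(x,y)$. With $-F=\{(x,-y):(x,y)\in F\}$, $\Delta^{\mathrm{ant}}(\mathcal H|_{X'})$ is the subcomplex of simplices $F$ with $-F$ also a simplex, equipped with the involution $\mu\mapsto-\mu$, $(-\mu)(x,y)=\mu(x,-y)$. The spherical dimension $\mathtt{sd}(\mathcal H)$ is the largest $n$ such that for some finite $X'\subseteq X$ there is a continuous map $f:\mathbb S^n\to\|\Delta^{\mathrm{ant}}(\mathcal H|_{X'})\|$ with $f(-v)=-f(v)$ for all $v$ ($-1$ if no such $n\ge0$ exists). *)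

(* Defs.v *)
From mathcomp Require Import all_boot all_order all_algebra finmap.
From mathcomp Require Import all_classical all_reals all_analysis.

Set Implicit Arguments.
Unset Strict Implicit.
Unset Printing Implicit Defensive.

Import Order.TTheory GRing.Theory Num.Theory.
Import numFieldNormedType.Exports.

Local Open Scope classical_set_scope.
Local Open Scope ring_scope.

(* The label set {-,+} is [bool], with [true] for + and [~~] for the sign
   change.  A class over X is a set [H : set (X -> bool)], and its
   nonemptiness is a hypothesis where it is needed.  Finite subsets of the
   arbitrary type X are elements of [{fset {classic X}}]; such a subset X'
   coerces to the finite type of its elements. *)

Definition shattered (X : Type) (H : set (X -> bool))
    (S : {fset {classic X}}) : Prop :=
  forall s : S -> bool, exists2 h, H h & forall x : S, h (val x) = s x.

(* Valued in the extended reals; it is +oo when arbitrarily large finite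
   sets are shattered. *)
Definition VC (R : realType) (X : Type) (H : set (X -> bool)) : \bar R :=
  ereal_sup [set (#|` S|%:R)%:E | S in shattered H].

Definition vertex (X : Type) (X' : {fset {classic X}}) : finType :=
  (X' * bool)%type.

Definition Delta (X : Type) (H : set (X -> bool)) (X' : {fset {classic X}}) :
    set {set vertex X'} :=
  [set F : {set vertex X'} |
    exists2 h, H h & forall p : vertex X', p \in F -> h (val p.1) = p.2].

Definition oppv (X : Type) (X' : {fset {classic X}}) (p : vertex X') :
    vertex X' := (p.1, ~~ p.2).

Definition Delta_ant (X : Type) (H : set (X -> bool))
    (X' : {fset {classic X}}) : set {set vertex X'} :=
  [set F : {set vertex X'} | Delta H F /\ Delta H [set oppv p | p in F]%SET].

(* A point of the geometric realization is the family of its barycentric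
   coordinates.  As V is finite, the topology of the realization is the
   one induced by the product topology on R^V. *)
Definition realization (R : realType) (V : finType) (K : set {set V}) :
    set {ptws V -> R} :=
  [set mu | [/\ forall v, 0 <= mu v, \sum_v mu v = 1
              & K [set v | mu v != 0]%SET]].

Definition oppd (R : realType) (X : Type) (X' : {fset {classic X}})
    (mu : {ptws vertex X' -> R}) : {ptws vertex X' -> R} :=
  fun p => mu (oppv p).

Definition sphere (R : realType) (n : nat) : set 'rV[R]_n.+1 :=
  [set v : 'rV[R]_n.+1 | \sum_i v ord0 i ^+ 2 = 1].

(* Only the restriction of f to the sphere is relevant. *)
Definition antipodal_map (R : realType) (n : nat) (X : Type)
    (H : set (X -> bool)) (X' : {fset {classic X}})
    (f : 'rV[R]_n.+1 -> {ptws vertex X' -> R}) : Prop :=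
  [/\ {within @sphere R n, continuous f},
      set_fun (@sphere R n) (realization (@Delta_ant X H X')) f
    & forall v, sphere v -> f (- v) = oppd (f v)].

(* -1 when there is no antipodal map at all, +oo when there are antipodal
   maps from spheres of arbitrarily large dimension. *)
Definition sd (R : realType) (X : Type) (H : set (X -> bool)) : \bar R :=
  ereal_sup ([set (-1)%:E] `|`
    [set (n%:R)%:E | n in [set n : nat | exists (X' : {fset {classic X}})
       (f : 'rV[R]_n.+1 -> {ptws vertex X' -> R}), antipodal_map H f]]).

(* Main.v *)
(* Fix r in H and let U_x be the set of h in H with h(x) <> r(x).  If no two
   points are shattered, the sets U_x form a laminar family.  A simplex of
   Delta_ant consists of vertices (x, r(x)), x in A, and (y, -r(y)), y in B,
   such that the U_x with x in A are pairwise comparable, likewise in B, and U_x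
   is disjoint from U_y for x in A and y in B.  In a laminar family disjoint
   pairs can be given an antisymmetric sign that does not change along
   comparable members, so a simplex with A and B nonempty has a sign.  Label a
   point by 0 or 2 when most of its mass is on B or on A, and by 1 or 3,
   according to this sign, otherwise.  The labels, read mod 4, turn by 2 under
   the antipode and never differ by 2 at nearby points.  Along a hemisphere of a
   2-sphere in the domain of the map, the winding number of the labels on
   circles of latitude would then be constant, zero at the pole and nonzero on
   the equator. *)
Require Import Defs.
From mathcomp Require Import all_boot all_order all_algebra finmap.
From mathcomp Require Import all_classical all_reals all_analysis.
From mathcomp Require Import zify ring lra.
Set Implicit Arguments.
Unset Strict Implicit.
Unset Printing Implicit Defensive.
Import Order.TTheory GRing.Theory Num.Theory.
Import numFieldNormedType.Exports.
Local Open Scope classical_set_scope.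
Local Open Scope ring_scope.

(** * Winding of sequences of labels *)

(* The four labels (false, false), (false, true), (true, true), (true, false),
   in this cyclic order, are the residues 0, 1, 2, 3 mod 4. *)
Definition residue (a : bool * bool) : int :=
  if a.1 then (if a.2 then 2 else 3) else (if a.2 then 1 else 0).

Definition opp_label (a : bool * bool) : bool * bool := (~~ a.1, ~~ a.2).

(** The representative in -1, 0, 1 of [residue b - residue a] mod 4; opposite labels, which differ
    by 2, get the default 0. *)
Definition winding_step (a b : bool * bool) : int :=
  if a.1 == b.1 then
    (if a.2 == b.2 then 0 else if a.1 == a.2 then 1 else - 1)
  else (if a.2 == b.2 then (if a.1 == a.2 then -1 else 1) else 0).

Lemma winding_step_residue a b : a != opp_label b ->
  (winding_step a b == residue b - residue a %[mod 4])%Z.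
Proof. by move: a b => [[] []] [[] []]. Qed.

(** Three pairwise non-opposite labels take at most two values, adjacent in the cycle, so a triangle
    has no winding. *)
Lemma winding_step_add a b c :
  a != opp_label b -> b != opp_label c -> a != opp_label c ->
  winding_step a b + winding_step b c = winding_step a c.
Proof. by move: a b c => [[] []] [[] []] [[] []]. Qed.

Lemma winding_step_opp a b :
  winding_step (opp_label a) (opp_label b) = winding_step a b.
Proof. by move: a b => [[] []] [[] []]. Qed.

Lemma winding_stepxx a : winding_step a a = 0.
Proof. by move: a => [[] []]. Qed.

Lemma winding_residue (u : nat -> bool * bool) n :
  (forall i, (i < n)%N -> u i != opp_label (u i.+1)) ->
  (\sum_(i < n) winding_step (u i) (u i.+1) == residue (u n) - residue (u 0%N)
    %[mod 4])%Z.
Proof.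
elim: n => [|n IH] near_u; first by rewrite big_ord0 subrr.
have {}IH := IH (fun i lt_in => near_u i (ltnW lt_in)).
rewrite big_ord_recr /=.
have := winding_step_residue (near_u n (ltnSn n)).
move: IH; set S := \sum_(_ < _) _; set t := winding_step _ _.
set a := residue (u 0%N); set b := residue (u n); set c := residue _.
by lia.
Qed.

(** Each square between the two rows is cut by the diagonal from [a n] to [b n.+1] into two
    triangles without winding. *)
Lemma winding_homotopy (a b : nat -> bool * bool) n :
  (forall i k, (i <= n)%N -> (k <= n)%N -> (i <= k.+1)%N -> (k <= i.+1)%N ->
    [/\ a i != opp_label (a k), a i != opp_label (b k)
      & b i != opp_label (b k)]) ->
  \sum_(i < n) winding_step (a i) (a i.+1) + winding_step (a n) (b n) =
  winding_step (a 0%N) (b 0%N) + \sum_(i < n) winding_step (b i) (b i.+1).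
Proof.
elim: n => [|n IH] near_ab; first by rewrite !big_ord0 add0r addr0.
have near_succ : [/\ a n != opp_label (a n.+1), a n != opp_label (b n.+1)
   & b n != opp_label (b n.+1)] by apply: near_ab; lia.
have [_ near_n _] : [/\ a n != opp_label (a n), a n != opp_label (b n)
   & b n != opp_label (b n)] by apply: near_ab; lia.
have [_ near_n1 _] : [/\ a n.+1 != opp_label (a n.+1),
  a n.+1 != opp_label (b n.+1) & b n.+1 != opp_label (b n.+1)].
  by apply: near_ab; lia.
case: near_succ => near_aa near_ab' near_bb.
rewrite !big_ord_recr /= -addrA winding_step_add //.
rewrite addrA -IH; last first.
  by move=> i k ? ? ? ?; apply: near_ab => //; apply: leqW.
by rewrite -addrA winding_step_add.
Qed.

(* A grid on the closed upper hemisphere: [i] is the longitude, of period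
   [N + N], the row [j = 0] is the equator and [j = M] is the pole.  The winding
   number of a row is independent of the row, vanishes at the pole and is twice
   an odd number at the equator. *)
Lemma hemisphere_opposite_labels (N M : nat) (lab : nat -> nat -> bool * bool) :
  (forall j, lab (N + N)%N j = lab 0%N j) ->
  (forall i, lab (N + i)%N 0%N = opp_label (lab i 0%N)) ->
  (forall i, lab i M = lab 0%N M) ->
  ~ (forall i k j l, (i <= N + N)%N -> (k <= N + N)%N -> (i <= k.+1)%N ->
       (k <= i.+1)%N -> (j <= M)%N -> (l <= M)%N -> (j <= l.+1)%N ->
       (l <= j.+1)%N -> lab i j != opp_label (lab k l)).
Proof.
move=> period antipode pole near_lab.
pose S j := \sum_(i < N + N) winding_step (lab i j) (lab i.+1 j).
have S0 j : (j <= M)%N -> S j = S 0%N.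
  elim: j => // j IH lt_jM; rewrite -IH ?(ltnW lt_jM) //; apply/esym.
  have := @winding_homotopy (lab^~ j) (lab^~ j.+1) (N + N)%N.
  rewrite !period [RHS]addrC => near_homotopy.
  apply: (addIr (winding_step (lab 0%N j) (lab 0%N j.+1))).
  rewrite near_homotopy; first by rewrite addrC.
  move=> i k le_i le_k ik ki.
  by split; apply: near_lab => //; rewrite ?(ltnW lt_jM) // leqW.
have SM : S M = 0.
  by rewrite /S big1 // => i _; rewrite !pole winding_stepxx.
pose D := \sum_(i < N) winding_step (lab i 0%N) (lab i.+1 0%N).
have SD : S 0%N = D + D.
  rewrite /S big_split_ord /=; congr (_ + _); apply: eq_bigr => i _.
  by rewrite -addnS !antipode winding_step_opp.
(* The ends of the half equator carry opposite labels, so [D] is 2 mod 4 and cannot vanish. *)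
have res : (D == residue (lab N 0%N) - residue (lab 0%N 0%N) %[mod 4])%Z.
  apply: (winding_residue (u := lab^~ 0%N)) => i lt_iN.
  by apply: near_lab => //; lia.
have D0 : D = 0 by have := S0 M (leqnn M); rewrite SM SD; lia.
move: res; rewrite D0 -[X in lab X 0%N]addn0 antipode.
by case: (lab 0%N 0%N) => [[] []].
Qed.

(** * Signs on laminar families *)

(** [meets x x] says that the set indexed by [x] is nonempty. Invariance in the second argument
    follows by antisymmetry. *)
Definition separating_sign (T : finType) (meets s : rel T) : Prop :=
  (forall x y, meets x x -> meets y y -> ~~ meets x y -> s y x = ~~ s x y) /\
  (forall x y z, meets z z -> meets x y -> ~~ meets x z -> ~~ meets y z ->
     s x z = s y z).

(* [meets] and [sub] are intersection and inclusion in a laminar family of sets.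
   The set [M x y] is determined by the largest member that contains [x] and is
   disjoint from [y], so it is unchanged when [x] or [y] is replaced by a
   comparable member; the ranks of [M x y] and [M y x] are then compared. *)
Lemma laminar_sign (T : finType) (meets sub : rel T) :
  reflexive sub -> transitive sub -> symmetric meets ->
  (forall x y, meets x y -> meets x x) ->
  (forall x y z, sub x y -> meets x z -> meets y z) ->
  (forall x y, meets x y -> sub x y || sub y x) ->
  exists s : rel T, separating_sign meets s.
Proof.
move=> subxx sub_trans meetsC meetsxx meets_sub laminar.
pose M x y := [set z | [exists w, [&& meets w x, ~~ meets w y & sub z w]]]%SET.
have M_subl x y z : sub x y -> meets x x -> ~~ meets y z -> M x z = M y z.
  move=> xy xx yz; apply/setP => t; rewrite !inE.
  apply/existsP/existsP => -[w /and3P[wx wz tw]].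
    by exists w; rewrite wz tw meetsC (meets_sub x) // meetsC.
  (* When [w] is inside [y] it may miss [x], and [y] itself becomes the witness. *)
  have [wy|yw] := orP (laminar _ _ wx).
    by exists y; rewrite yz (meets_sub x) //= (sub_trans w).
  by exists w; rewrite wz tw (meets_sub y) // (meets_sub x).
have M_subr x y z : sub x y -> meets x x -> ~~ meets y z -> M z x = M z y.
  move=> xy xx yz; apply/setP => t; rewrite !inE.
  apply/existsP/existsP => -[w /and3P[wz wx tw]]; exists w; rewrite wz tw andbT.
    apply/negP => wy; have [w_y|yw] := orP (laminar _ _ wy).
      by move: yz; rewrite (meets_sub w).
    by move: wx; rewrite (meets_sub y) // (meets_sub x).
  by apply: contra wx => wx; rewrite meetsC (meets_sub x) // meetsC.
(* For disjoint nonempty [x] and [y], [x] belongs to [M x y] but not to [M y x], so the ranks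
   differ. *)
exists (fun x y => (enum_rank (M x y) < enum_rank (M y x))%N); split.
  move=> x y xx yy xy; rewrite -leqNgt ltn_neqAle.
  rewrite (inj_eq val_inj) (inj_eq enum_rank_inj).
  suff -> : M y x != M x y by [].
  apply/eqP => /setP/(_ x); rewrite !inE.
  have -> : [exists w, [&& meets w x, ~~ meets w y & sub x w]].
    by apply/existsP; exists x; rewrite xx xy subxx.
  move/existsP => [w /and3P[_ wx xw]].
  by move: wx; rewrite (meets_sub x).
move=> x y z zz xy xz yz.
have xx := meetsxx _ _ xy.
have yy : meets y y by apply: (meetsxx _ x); rewrite meetsC.
have [xy'|yx] := orP (laminar _ _ xy).
  by rewrite (M_subl x y) // (M_subr x y).
by rewrite (M_subl y x) // (M_subr y x).
Qed.

(** * Labels of points of the complex *)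

(* [u] and [v] are the masses of a point of the complex on its sides A, B. *)
Definition two_chains (R : realDomainType) (T : finType) (meets : rel T)
    (u v : T -> R) : Prop :=
  [/\ forall x y, 0 < u x -> 0 < u y -> meets x y,
      forall x y, 0 < v x -> 0 < v y -> meets x y &
      forall x y, 0 < u x -> 0 < v y -> ~~ meets x y].

(** With total mass 1, if neither side exceeds 2/3 then both have at least 1/3, hence a pair from
    which to read the sign. *)
Definition chain_label (R : realFieldType) (T : finType) (s : rel T)
    (u v : T -> R) : bool * bool :=
  if 2 / 3 < \sum_x v x then (false, false) else
  if 2 / 3 < \sum_x u x then (true, true) else
  let b := [exists x, exists y, [&& 0 < u x, 0 < v y & s x y]] in (~~ b, b).

Lemma exists_big_term (R : realFieldType) (T : finType) (u : T -> R) (e : R) :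
  0 <= e -> e *+ #|T| < \sum_x u x -> exists x, e < u x.
Proof.
move=> e0 sum_u; apply/existsP; rewrite -[X in is_true X]negbK; apply/negP.
rewrite negb_exists => /forallP small; move: sum_u.
rewrite ltNge => /negP; apply.
rewrite -sumr_const; apply: ler_sum => x _.
by rewrite leNgt.
Qed.

(** Members of one side meet each other, so [x] can be exchanged directly and [y] through
    antisymmetry. *)
Lemma chain_sign (R : realDomainType) (T : finType) (meets s : rel T)
    (u v : T -> R) x y :
  separating_sign meets s -> symmetric meets -> two_chains meets u v ->
  0 < u x -> 0 < v y ->
  [exists x, exists y, [&& 0 < u x, 0 < v y & s x y]] = s x y.
Proof.
move=> [s_opp s_meets] meetsC [uu vv uv] ux vy.
apply/existsP/idP => [[x' /existsP[y' /and3P[ux' vy' sxy']]]|sxy].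
  rewrite (s_meets x x') //; [|exact: vv|exact: uu|exact: uv|exact: uv].
  rewrite -[s x' y]negbK -s_opp; [|exact: uu|exact: vv|exact: uv].
  rewrite (s_meets y y');
    [|exact: uu|exact: vv|rewrite meetsC; exact: uv|rewrite meetsC; exact: uv].
  by rewrite s_opp ?sxy' //; [exact: uu|exact: vv|exact: uv].
by exists x; apply/existsP; exists y; rewrite ux vy.
Qed.

Lemma chain_label_opp (R : realFieldType) (T : finType) (meets s : rel T)
    (u v : T -> R) :
  separating_sign meets s -> symmetric meets -> two_chains meets u v ->
  \sum_x u x + \sum_x v x = 1 ->
  chain_label s v u = opp_label (chain_label s u v).
Proof.
move=> s_sep meetsC uv_chains; have [uu vv uv] := uv_chains.
rewrite /chain_label; set a := \sum_x u x; set b := \sum_x v x => ab1.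
case: (ltP (2 / 3) a) => ha; case: (ltP (2 / 3) b) => hb //.
  by exfalso; lra.
have [||x ux] := @exists_big_term _ _ u 0; [by []|by rewrite mul0rn -/a; lra|].
have [||y vy] := @exists_big_term _ _ v 0; [by []|by rewrite mul0rn -/b; lra|].
have vu_chains : two_chains meets v u.
  by split=> // x' y' vx' uy'; rewrite meetsC; exact: uv.
rewrite (chain_sign s_sep meetsC uv_chains ux vy).
rewrite (chain_sign s_sep meetsC vu_chains vy ux).
case: s_sep => s_opp _.
by rewrite s_opp //; [exact: uu|exact: vv|exact: uv].
Qed.

(** Passing between labels 0 and 2 moves a mass by more than 1/3, beyond the total change
    [e *+ #|T|]. For labels 1 and 3, each side has a term above [e], which stays positive at the
    other point, so both signs are read from a common pair. *)
Lemma chain_label_near (R : realFieldType) (T : finType) (meets s : rel T)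
    (u v u' v' : T -> R) (e : R) :
  separating_sign meets s -> symmetric meets ->
  two_chains meets u v -> two_chains meets u' v' ->
  \sum_x u x + \sum_x v x = 1 -> \sum_x u' x + \sum_x v' x = 1 ->
  0 <= e -> e *+ #|T| < 1 / 3 ->
  (forall x, `|u x - u' x| <= e) -> (forall x, `|v x - v' x| <= e) ->
  chain_label s u v != opp_label (chain_label s u' v').
Proof.
move=> s_sep meetsC uv_chains uv_chains' sum_uv sum_uv' e0 small_e uu' vv'.
have dist (w w' : T -> R) : (forall x, `|w x - w' x| <= e) ->
    `|\sum_x w x - \sum_x w' x| <= e *+ #|T|.
  move=> ww'; rewrite -sumrB (le_trans (ler_norm_sum _ _ _)) //.
  by rewrite -sumr_const; exact: ler_sum.
have := dist _ _ uu'; have := dist _ _ vv'; rewrite !ler_norml.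
move: sum_uv sum_uv'.
move: (@exists_big_term _ _ u _ e0) (@exists_big_term _ _ v _ e0).
rewrite /chain_label; set a := \sum_x u x; set b := \sum_x v x.
set a' := \sum_x u' x; set b' := \sum_x v' x => big_u big_v ab ab'.
move=> /andP[b1 b2] /andP[a1 a2].
case: (ltP (2 / 3) b) => hb; case: (ltP (2 / 3) b') => hb' //;
case: (ltP (2 / 3) a) => ha; case: (ltP (2 / 3) a') => ha' //=;
  try (exfalso; lra); try by case: [exists x, _].
have [|x ux] := big_u; first by lra.
have [|y vy] := big_v; first by lra.
have ux' : 0 < u' x by move: (uu' x); rewrite ler_norml => /andP[_]; lra.
have vy' : 0 < v' y by move: (vv' y); rewrite ler_norml => /andP[_]; lra.
rewrite (chain_sign (x := x) (y := y) s_sep meetsC uv_chains); [|lra|lra].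
rewrite (chain_sign s_sep meetsC uv_chains' ux' vy').
by case: (s x y).
Qed.

(** * Uniform continuity and the parametrized hemisphere *)

Lemma compact_unif_ptws (R : realType) (U : pseudoMetricType R) (V : finType)
    (G : U -> {ptws V -> R}) (K : set U) (e : R) :
  continuous G -> compact K -> 0 < e ->
  exists2 d : R, 0 < d &
    forall p q, K p -> ball p d q -> forall v, `|G p v - G q v| < e.
Proof.
move=> Gcont /compact_near_coveringP Kcomp e0.
pose P (d : R) p := forall q, ball p d q -> forall v, `|G p v - G q v| < e.
have {}Kcomp := Kcomp R (0 : R)^'+ P _.
suff /Kcomp : forall x, K x -> \forall x' \near x & i \near 0^'+, P i x'.
  move=> near_d; near ((0 : R)^'+) => d; exists d => // p q Kp.
  by apply: (near near_d d).
move=> x Kx.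
have Gv v : continuous (fun p => G p v).
  by move=> p; apply: (@continuous_comp _ _ _ G (fun g => g v));
    [exact: Gcont|exact: proj_continuous].
have : \forall y \near x, forall v, `|G x v - G y v| < e / 2.
  apply: filter_forall => v.
  by have /cvgrPdist_lt := Gv v x; apply; rewrite divr_gt0.
move=> /nbhs_ballP [d /= d0 xd].
(* Half the radius keeps both [y] and [z] in the ball of radius [d] at [x], where values are within
   [e / 2] of those at [x]. *)
exists (ball x (d / 2), [set i | i < d / 2]) => /=.
  split; first by apply: nbhsx_ballx; rewrite divr_gt0.
  by apply: nbhs_right_lt; rewrite divr_gt0.
move=> [y i] /= [xy id] z yz v.
have /xd/(_ v) : ball x d y by apply: le_ball xy; rewrite ler_pdivrMr //; lra.
have /xd/(_ v) : ball x d z.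
  rewrite (splitr d); apply: ball_triangle xy _.
  by apply: le_ball yz; exact: ltW.
rewrite !ltr_norml => /andP[? ?] /andP[? ?]; apply/andP; split; lra.
Unshelve. all: by end_near.
Qed.

(** Longitude [p.1] and latitude [p.2] on the 2-sphere of the first three coordinates; the default
    of [nth] pads with zeros, which covers all dimensions from 2 on. *)
Definition hemisphere (R : realType) (n : nat) (p : R * R) : 'rV[R]_n.+3 :=
  \row_(i < n.+3) nth 0
    [:: cos p.2 * cos p.1; cos p.2 * sin p.1; sin p.2] i.

Lemma hemisphere_sphere (R : realType) (n : nat) (p : R * R) :
  @sphere R n.+2 (hemisphere n p).
Proof.
rewrite /sphere /= !big_ord_recl /= big1 => [|i _]; last first.
  by rewrite mxE /= nth_nil expr0n.
rewrite !mxE /= addr0 !exprMn addrA -mulrDr cos2Dsin2 mulr1; exact: cos2Dsin2.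
Qed.

Lemma hemisphere_continuous (R : realType) (n : nat) :
  continuous (@hemisphere R n).
Proof.
have comp_fst (g : R -> R) (p : R * R) : continuous g ->
    g q.1 @[q --> p] --> g p.1.
  by move=> g_cont; apply: continuous_cvg; [exact: g_cont|exact: cvg_fst].
have comp_snd (g : R -> R) (p : R * R) : continuous g ->
    g q.2 @[q --> p] --> g p.2.
  by move=> g_cont; apply: continuous_cvg; [exact: g_cont|exact: cvg_snd].
move=> p; apply/cvg_ballP => e e0.
have coord (i : 'I_n.+3) :
    hemisphere n q ord0 i @[q --> p] --> hemisphere n p ord0 i.
  have -> : (fun q => hemisphere n q ord0 i) = fun q : R * R =>
    nth 0 [:: cos q.2 * cos q.1; cos q.2 * sin q.1; sin q.2] i.
    by apply/funext => q; rewrite mxE.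
  rewrite mxE; case: i => [[|[|[|i]]] ?] /=.
  - apply: cvgM; first exact/comp_snd/continuous_cos.
    exact/comp_fst/continuous_cos.
  - apply: cvgM; first exact/comp_snd/continuous_cos.
    exact/comp_fst/continuous_sin.
  - exact/comp_snd/continuous_sin.
  - have -> : (fun _ : R * R => nth 0 [::] i) = (fun=> 0 : R).
      by apply/funext => q; rewrite nth_nil.
    by rewrite nth_nil; exact: cvg_cst.
have : \forall q \near p, forall i,
    ball (hemisphere n p ord0 i) e (hemisphere n q ord0 i).
  apply: (@filter_forall _ _ _ _ (nbhs_filter p)) => i.
  by have /cvg_ballP/(_ e e0) := coord i.
by apply: filterS => q pq; split=> // i j; rewrite ord1.
Qed.

Lemma hemisphere_antipode (R : realType) (n : nat) (t : R) :
  hemisphere n (pi + t, 0) = - hemisphere n (t, 0).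
Proof.
apply/rowP => i; rewrite !mxE /= addrC sinDpi cosDpi sin0 !mulrN.
by case: i => [[|[|[|i]]] ?] //=; rewrite ?nth_nil oppr0.
Qed.

Lemma hemisphere_period (R : realType) (n : nat) (s t : R) :
  hemisphere n (t + pi *+ 2, s) = hemisphere n (t, s).
Proof. by apply/rowP => i; rewrite !mxE /= sinD2pi cosD2pi. Qed.

Lemma hemisphere_pole (R : realType) (n : nat) (t u : R) :
  hemisphere n (t, pi / 2) = hemisphere n (u, pi / 2).
Proof. by apply/rowP => i; rewrite !mxE /= cos_pihalf !mul0r. Qed.


(** As [hemisphere] stays on the sphere, it converges along the within filter, where [f] is known to
    be continuous. *)
Lemma hemisphere_map_continuous (R : realType) (n : nat) (U : topologicalType)
    (f : 'rV[R]_n.+3 -> U) :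
  {within @sphere R n.+2, continuous f} -> continuous (f \o hemisphere n).
Proof.
move=> /subspace_continuousP f_cont p.
have to_sphere :
    hemisphere n q @[q --> p] -->
    within (@sphere R n.+2) (nbhs (hemisphere n p)).
  move=> A sA; have near_p : \forall q \near p,
    sphere (hemisphere n q) -> A (hemisphere n q) := hemisphere_continuous sA.
  apply: (@filterS _ (nbhs p) _ _ _ _ near_p) => q; apply.
  exact: hemisphere_sphere.
exact: (cvg_comp _ _ to_sphere (f_cont _ (hemisphere_sphere n p))).
Qed.

(** * From an antipodal map to a shattered pair *)

Lemma antipodal_map_pair (R : realType) (n : nat) (X : Type)
    (H : set (X -> bool)) (X' : {fset {classic X}})
    (f : 'rV[R]_n.+3 -> {ptws vertex X' -> R}) :
  H !=set0 -> antipodal_map H f ->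
  exists x y : X', forall a b, exists2 h, H h & h (val x) = a /\ h (val y) = b.
Proof.
move=> [r Hr] [f_cont f_real f_odd]; apply: contrapT => no_pair.
pose D (h : X -> bool) (x : X') := h (val x) != r (val x).
(* On [x], [y] the functions [r], [h1], [h2], [h3] differ from [r] in the patterns 00, 11, 10, 01,
   which yield all four labelings. *)
have no_square x y h1 h2 h3 : H h1 -> H h2 -> H h3 -> D h1 x -> D h1 y ->
    D h2 x -> ~~ D h2 y -> ~~ D h3 x -> D h3 y -> False.
  rewrite /D => H1 H2 H3 x1 y1 x2 y2 x3 y3; apply: no_pair; exists x, y => a b.
  case: (eqVneq a (r (val x))) => [ax|ax]; case: (eqVneq b (r (val y))) => yb.
  - by exists r.
  - exists h3 => //; move: ax yb x3 y3.
    by case: a b (h3 _) (r _) (h3 _) (r _) => [] [] [] [] [] [].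
  - exists h2 => //; move: ax yb x2 y2.
    by case: a b (h2 _) (r _) (h2 _) (r _) => [] [] [] [] [] [].
  - exists h1 => //; move: ax yb x1 y1.
    by case: a b (h1 _) (r _) (h1 _) (r _) => [] [] [] [] [] [].
pose meets (x y : X') := `[< exists2 h, H h & D h x && D h y >].
pose sub (x y : X') := `[< forall h, H h -> D h x -> D h y >].
have meetsC : symmetric meets.
  by move=> x y; apply/asboolP/asboolP => -[h Hh]; rewrite andbC; exists h.
have [||||||s s_sep] := @laminar_sign _ meets sub.
- by move=> x; apply/asboolP.
- move=> y x z /asboolP xy /asboolP yz; apply/asboolP => h Hh xh.
  by apply: yz => //; exact: xy.
- exact: meetsC.
- move=> x y /asboolP[h Hh /andP[xh _]]; apply/asboolP; exists h => //.
  by rewrite xh.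
- move=> x y z /asboolP xy /asboolP[h Hh /andP[xh zh]]; apply/asboolP.
  by exists h => //; rewrite zh xy.
- move=> x y /asboolP[h Hh /andP[xh yh]].
  apply: contrapT => /negP; rewrite negb_or => /andP[/asboolPn xy /asboolPn yx].
  move: xy yx => /existsNP[h2 /not_implyP[H2 /not_implyP[x2 /negP y2]]].
  move=> /existsNP[h3 /not_implyP[H3 /not_implyP[y3 /negP x3]]].
  exact: (no_square x y h h2 h3).
pose up (mu : {ptws vertex X' -> R}) (x : X') : R := mu (x, r (val x)).
pose dn (mu : {ptws vertex X' -> R}) (x : X') : R := mu (x, ~~ r (val x)).
have chains mu : realization (Delta_ant H (X' := X')) mu ->
    two_chains meets (up mu) (dn mu).
  (* [h] realizes the support of [mu] and [h'] its antipode, so [h'] differs from [r] on A but not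
     on B, and [h] on B but not on A. A member differing from [r] at a point of each would complete
     a square. *)
  move=> [_ _ [[h Hh h_mu] [h' Hh' h'_mu]]].
  have up_h x : 0 < up mu x -> ~~ D h x /\ D h' x.
    move=> /lt0r_neq0 mux; rewrite /D negbK; split.
      by apply/eqP; apply: (h_mu (x, _)); rewrite inE.
    have /= -> := h'_mu (oppv (x, r (val x))); last first.
      by apply/imsetP; exists (x, r (val x)); rewrite ?inE.
    by case: (r _).
  have dn_h x : 0 < dn mu x -> D h x /\ ~~ D h' x.
    move=> /lt0r_neq0 mux; rewrite /D negbK; split.
      have /= -> := h_mu (x, ~~ r (val x)); last by rewrite inE.
      by case: (r _).
    have /= -> := h'_mu (oppv (x, ~~ r (val x))); last first.
      by apply/imsetP; exists (x, ~~ r (val x)); rewrite ?inE.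
    by rewrite negbK.
  split.
  - move=> x y /up_h[_ x'] /up_h[_ y']; apply/asboolP; exists h' => //.
    by rewrite x' y'.
  - move=> x y /dn_h[x' _] /dn_h[y' _]; apply/asboolP; exists h => //.
    by rewrite x' y'.
  - move=> x y /up_h[xh xh'] /dn_h[yh yh']; apply/asboolPn.
    by move=> [h1 H1 /andP[x1 y1]]; exact: (no_square x y h1 h' h).
have mass mu : realization (Delta_ant H (X' := X')) mu ->
    \sum_x up mu x + \sum_x dn mu x = 1.
  move=> [_ <- _]; rewrite -big_split /=.
  have -> : \sum_p mu p = \sum_x \sum_b mu (x, b).
    by rewrite pair_bigA; apply: eq_bigr => -[].
  apply: eq_bigr => x _; rewrite big_bool /up /dn.
  by case: (r _) => //; rewrite addrC.
(* The successor keeps [e] positive when [X'] is empty. *)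
pose e : R := (4 * #|{: X'}|.+1%:R)^-1.
have e0 : 0 < e by rewrite invr_gt0 mulr_gt0.
have small_e : e *+ #|{: X'}| < 1 / 3.
  rewrite -[e *+ _]mulr_natl ltr_pdivrMr ?mulr_gt0 // -(natr1 #|{: X'}|).
  have := ler0n R #|{: X'}|; lra.
pose G (p : R * R) := f (hemisphere n p).
have G_real p : realization (Delta_ant H (X' := X')) (G p).
  by apply: f_real; exact: hemisphere_sphere.
pose K := `[0, pi *+ 2 : R] `*` `[0, pi / 2 : R].
have [|d d0 unif] := @compact_unif_ptws R _ _ G K e
    (hemisphere_map_continuous f_cont) _ e0.
  by apply: compact_setX; exact: segment_compact.
(* With [N] steps per half turn and [N] rows up to the pole, one step moves either angle by at most
   [pi / N%:R], which is below [d]. *)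
pose N := (Num.truncn (pi / d)).+1.
have N0 : 0 < N%:R :> R by rewrite ltr0n.
have step_d : pi / N%:R < d.
  rewrite ltr_pdivrMr // mulrC -ltr_pdivrMr //.
  by rewrite truncnS_gt // divr_ge0 ?pi_ge0 // ltW.
pose grid (i j : nat) : R * R := (pi * i%:R / N%:R, pi / 2 * j%:R / N%:R).
pose lab i j := chain_label s (up (G (grid i j))) (dn (G (grid i j))).
apply: (@hemisphere_opposite_labels N N lab).
- move=> j; rewrite /lab; suff -> : G (grid (N + N) j) = G (grid 0 j) by [].
  rewrite /G -(hemisphere_period _ _ (grid 0 j).1).
  congr (f (hemisphere n (_, _))).
  by rewrite natrD /= mulr0 mul0r add0r; field; rewrite gt_eqF.
- move=> i; rewrite /lab -(chain_label_opp s_sep meetsC);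
    [|exact: chains|exact: mass].
  have -> : G (grid (N + i) 0) = oppd (G (grid i 0)).
    rewrite /G -f_odd; last exact: hemisphere_sphere.
    rewrite /grid !mulr0 !mul0r -hemisphere_antipode.
    congr (f (hemisphere n (_, _))).
    by rewrite natrD; field; rewrite gt_eqF.
  by congr chain_label; apply/funext => x;
    rewrite /up /dn /oppd /oppv //= negbK.
- move=> i; rewrite /lab; suff -> : G (grid i N) = G (grid 0 N) by [].
  have pole : pi / 2 * N%:R / N%:R = pi / 2 :> R by rewrite mulfK // gt_eqF.
  by rewrite /G /grid pole; congr f; exact: hemisphere_pole.
move=> i k j l le_i le_k ik ki le_j le_l jl lj.
have near_lab v : `|G (grid i j) v - G (grid k l) v| <= e.
  apply/ltW/unif.
    split=> /=; rewrite in_itv /=; apply/andP; split.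
    + by rewrite divr_ge0 ?mulr_ge0 ?pi_ge0.
    + rewrite ler_pdivrMr //.
      rewrite (_ : pi *+ 2 * N%:R = pi * (2 * N%:R)); last by ring.
      by rewrite ler_wpM2l ?pi_ge0 // -natrM ler_nat; lia.
    + by rewrite divr_ge0 ?mulr_ge0 ?pi_ge0 // divr_ge0 ?pi_ge0.
    + by rewrite ler_pdivrMr // ler_wpM2l ?divr_ge0 ?pi_ge0 // ler_nat.
  have near_step (c : R) (a b : nat) : 0 <= c -> c <= pi ->
      (a <= b.+1)%N -> (b <= a.+1)%N ->
      `|c * a%:R / N%:R - c * b%:R / N%:R| < d.
    move=> c0 c_pi ab ba; apply: le_lt_trans step_d.
    rewrite -mulrBl -mulrBr !normrM normfV (ger0_norm c0) (gtr0_norm N0).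
    rewrite ler_wpM2r ?invr_ge0 ?(ltW N0) // -[leRHS]mulr1 ler_pM //.
    have : a%:R <= b%:R + 1 :> R by rewrite natr1 ler_nat.
    have : b%:R <= a%:R + 1 :> R by rewrite natr1 ler_nat.
    by move=> ? ?; rewrite ler_norml; apply/andP; split; lra.
  have := pi_ge0 R => pi0.
  by split; apply: near_step => //; lra.
apply: (chain_label_near s_sep meetsC _ _ _ _ (ltW e0) small_e).
- exact: chains.
- exact: chains.
- exact: mass.
- exact: mass.
- by move=> x; exact: near_lab.
- by move=> x; exact: near_lab.
Qed.

Lemma antipodal_map_VC (R : realType) (n : nat) (X : Type)
    (H : set (X -> bool)) (X' : {fset {classic X}})
    (f : 'rV[R]_n.+3 -> {ptws vertex X' -> R}) :
  H !=set0 -> antipodal_map H f -> (2%:E <= VC R H)%E.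
Proof.
move=> H0 /(antipodal_map_pair H0)[x [y xy]].
have x_neq_y : val x != val y.
  have [h _ [hx hy]] := xy true false.
  by apply/eqP => x_y; move: hx; rewrite x_y hy.
apply: (@le_trans _ _ (#|` [fset val x; val y]%fset|%:R)%:E).
  by rewrite cardfs2 x_neq_y.
apply: ereal_sup_ubound; exists [fset val x; val y]%fset => // s.
have xS : val x \in [fset val x; val y]%fset by rewrite !inE eqxx.
have yS : val y \in [fset val x; val y]%fset by rewrite !inE eqxx orbT.
have [h Hh [hx hy]] := xy (s [` xS]%fset) (s [` yS]%fset).
exists h => // z; have := valP z; rewrite !inE => /orP[]/eqP zE.
  by rewrite zE hx; congr s; apply/val_inj.
by rewrite zE hy; congr s; apply/val_inj.
Qed.

Local Open Scope ereal_scope.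

Theorem theorem1p9 (R : realType) (X : Type) (H : set (X -> bool))
    (H0 : H !=set0) :
  (VC R H <= 1 -> sd R H <= 1) /\ (2%:E <= sd R H -> 2%:E <= VC R H).
Proof.
have small_sd : ~ 2%:E <= VC R H -> sd R H <= 1.
  move=> small_VC; apply: ge_ereal_sup => _ [->|[n [X' [f f_anti]] <-]].
    by rewrite lee_fin; lra.
  case: n f f_anti => [|[|n]] f f_anti; try by rewrite lee_fin.
  by exfalso; apply: small_VC; exact: antipodal_map_VC f_anti.
split=> [VC1|sd2].
  by apply: small_sd => /le_trans/(_ VC1); rewrite lee_fin; lra.
apply: contrapT => /small_sd /(le_trans sd2); rewrite lee_fin; lra.
Qed.
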